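(* Let $\gamma:[0,1]\to\mathbb{R}^d$ be a twice-continuously-differentiable unit-speed path such that the map $s\mapsto|\gamma''_s|$ is non-vanishing on $[0,1]$ and is differentiable with bounded derivative. Then there exist real constants $a<b$ and a twice-differentiable function $F:(a,b)\to[0,1]$ such that $$F(t)=\int_a^t|\gamma''_{F(s)}|^{-1}\,ds\quad (t\in(a,b)),\qquad\lim_{s\to a^+}F(s)=0,\qquad\lim_{s\to b^-}F(s)=1,$$ and such that $F$ is the cumulative distribution function of a probability measure $\mu$ supported on $(a,b)$, with density $f$, satisfying the following four conditions: A. $f$ is positive and differentiable on $(a,b)$; B. $I(t)=|\gamma''_t|^{-1}$ for almost every $t\in(0,1)$; C. $\sup_{a<x<b}\frac{F(x)(1-F(x))}{f(x)^2}|f'(x)|<\infty$; D. $J_2(\mu)<\infty$.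
   Context: $|\cdot|$ is the Euclidean norm; unit-speed means $|\gamma'_s|=1$ for all $s$. For a probability measure $\mu$ with density $f$ and distribution function $F$ supported on $(a,b)$, the $I$-function is $I(t):=f(F^{-1}(t))$, $t\in(0,1)$, and $J_2(\mu):=\int_a^b\frac{F(x)(1-F(x))}{f(x)}\,dx$. *)

(* Defs.v *)
From HB Require Import structures.
From mathcomp Require Import all_boot all_order all_algebra.
From mathcomp Require Import all_classical all_reals all_analysis.

Set Implicit Arguments.
Unset Strict Implicit.
Unset Printing Implicit Defensive.

Import Order.TTheory GRing.Theory Num.Theory.
Import numFieldNormedType.Exports.

Local Open Scope classical_set_scope.
Local Open Scope ring_scope.

(* The canonical norm on ['rV[R]_d] is the sup norm (it induces the same
   topology), so the Euclidean norm has to be defined separately. *)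
Definition enorm (R : realType) (d : nat) (v : 'rV[R]_d) : R :=
  Num.sqrt (\sum_(i < d) v ord0 i ^+ 2).

(* [g'] is the derivative of [g|_A]: the difference quotient at [s] is taken
   along points of [A] only. For [A = `[0, 1]] these are ordinary derivatives
   inside and one-sided derivatives at 0 and 1, they are unique on [A], and the
   values of [g] and [g'] outside [A] are irrelevant. *)
Definition is_derivative_on (R : realType) (V : normedModType R)
    (A : set R) (g g' : R -> V) : Prop :=
  forall s, A s ->
    (t - s)^-1 *: (g t - g s) @[t --> within A s^'] --> g' s.

Definition is_C2_on (R : realType) (V : normedModType R)
    (A : set R) (g g' g'' : R -> V) : Prop :=
  [/\ is_derivative_on A g g', is_derivative_on A g' g'' &
      {within A, continuous g''}].

Definition has_density (R : realType)
    (mu : probability (measurableTypeR R) R) (f : R -> R) : Prop :=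
  [/\ measurable_fun [set: measurableTypeR R] f,
      forall x, 0 <= f x &
      forall A : set (measurableTypeR R), measurable A ->
        (mu A = \int[lebesgue_measure]_(x in A) (f x)%:E)%E].

(* The partial inverse [pinv] of [F] on [(a, b)] is the genuine inverse
   function on [(0, 1)] as soon as [F] maps [(a, b)] bijectively onto [(0, 1)];
   this is the case for a distribution function with positive density on
   [(a, b)]. *)
Definition I_function (R : realType) (a b : R) (F f : R -> R) (t : R) : R :=
  f (pinv `]a, b[ F t).

Definition J2 (R : realType) (a b : R) (F f : R -> R) : \bar R :=
  (\int[lebesgue_measure]_(x in `]a, b[) (F x * (1 - F x) / f x)%R%:E)%E.

(* Main.v *)
Require Import Defs.
From HB Require Import structures.
From mathcomp Require Import all_boot all_order all_algebra.
From mathcomp Require Import all_classical all_reals all_analysis.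
From mathcomp Require Import measurable_realfun ring lra.
Import Order.TTheory GRing.Theory Num.Theory.
Import numFieldNormedType.Exports.
Local Open Scope classical_set_scope.
Local Open Scope ring_scope.

(** Write [k s] for the norm of [gamma'' s]. The integral equation asks for a
    solution of the autonomous equation [F' = 1 / k(F)] that climbs from 0 to 1,
    and separation of variables gives it: [F] is the inverse function of a
    primitive [H] of [k], on the interval from [a = H 0] to [b = H 1]
    ([inverse_primitive]). This interval is bounded with [a < b] because [k] is
    continuous and positive on [[0, 1]]. The path itself enters only through
    [k].

    To have two-sided derivatives of [F] at [a] and [b] as well, [k] is first
    extended to the line by the constants [k 0] and [k 1] ([clamp_extension]).
    The limits of [F] at the endpoints are then continuity statements, and the
    integral equation is the fundamental theorem of calculus on closed intervals
    ([integral_derive_itvoo]).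

    The measure has density [f = F' = 1 / k(F)] on [(a, b)] and 0 elsewhere; it
    has mass [F b - F a = 1] ([has_density_exists]). The four conditions follow
    from this formula. For A, the chain rule gives [f' = - k'(F) / k(F) ^ 3].
    For B, [F] is a bijection from [(a, b)] onto [(0, 1)], so [I = 1 / k] at
    every point. For C, the quantity under the supremum is
    [F (1 - F) |k'(F)| / k(F)], at most [sup |k'| / min k]. For D, the integrand
    [F (1 - F) k(F)] is at most [max k] and the interval is bounded. *)

(** * Derivatives relative to a set *)

(** [g t - g s] is [t - s] times a difference quotient that converges. *)
Lemma is_derivative_on_continuous (R : realType) (V : normedModType R)
    (A : set R) (g g' : R -> V) (s : R) :
  is_derivative_on A g g' -> A s -> g t @[t --> within A (nbhs s)] --> g s.
Proof.
move=> dg As.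
have FA : Filter (within A s^') by exact: within_filter.
have dAs : within A s^' --> s.
  by apply: cvg_trans; [apply: cvg_within|apply: cvg_within].
have cts : (t - s) *: ((t - s)^-1 *: (g t - g s))
    @[t --> within A s^'] --> (0 : V).
  rewrite -(scale0r (g' s)) -[X in X *: g' s](subrr s).
  by apply: cvgZ; [apply: cvgB => //; exact: cvg_cst|exact: dg].
apply/cvgrPdist_lt => e e0.
have : nbhs s (fun t : R => t != s -> A t ->
    `|(t - s) *: ((t - s)^-1 *: (g t - g s))| < e).
  by move/cvgr0Pnorm_lt : cts => /(_ e e0).
apply: filterS => t ht At; have [->|ts] := eqVneq t s.
  by rewrite subrr normr0.
by have := ht ts At; rewrite scalerA divff ?subr_eq0// scale1r distrC.
Qed.

(** Near an interior point of [A], relative and ordinary difference quotients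
    have the same domain; the shift by [s] turns one limit into the other. *)
Lemma is_derivative_on_is_derive (R : realType) (V : normedModType R)
    (A : set R) (g g' : R -> V) (s : R) :
  is_derivative_on A g g' -> nbhs s A -> is_derive s 1 g (g' s).
Proof.
move=> dg sA; have As : A s by exact: nbhs_singleton.
have lim_dg : h^-1 *: (g (h *: 1 + s) - g s) @[h --> 0^'] --> g' s.
  apply: cvg_trans (dg s As).
  pose q (t : R) : V := (t - s)^-1 *: (g t - g s).
  have -> : (fun h : R => h^-1 *: (g (h *: 1 + s) - g s)) =
      q \o (fun h : R => h + s).
    by apply/funext => h; rewrite /q/= -[h *: 1]/(h * 1) mulr1 addrK.
  have shift_s : h + s @[h --> (0 : R)] --> s.
    rewrite -[X in _ --> X]add0r.
    by apply: cvgD; [exact: cvg_id|exact: cvg_cst].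
  move=> P qP.
  have : nbhs s (fun t : R => t != s -> P (q t)).
    have : nbhs s (fun t : R => t != s -> A t -> P (q t)) by exact: qP.
    by move=> qA; apply: filterS (filterI sA qA) => t [At Pt] ts; exact: Pt.
  move=> qs.
  have {qs} : nbhs (0 : R) (fun h : R => h + s != s -> P (q (h + s))).
    exact: shift_s qs.
  have sub : (fun h : R => h + s != s -> P (q (h + s))) `<=`
      (fun h : R => h != 0 -> P (q (h + s))).
    by move=> h /= + h0; apply; rewrite -subr_eq0 addrK.
  exact: filterS sub.
by split; [apply/cvg_ex; exists (g' s)|apply: cvg_lim].
Qed.

(** The clamping map is continuous from the line into [[a, b]], so only the
    continuity of [k] relative to that interval matters. *)
Lemma clamp_extension (R : realType) (k : R -> R) (a b : R) :
  a <= b -> {within `[a, b], continuous k} ->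
  continuous (fun s => k (Num.max a (Num.min b s))).
Proof.
move=> ab kc s.
have /subspace_continuousP/(_ (Num.max a (Num.min b s))) := kc.
have cl x : `[a, b]%classic (Num.max a (Num.min b x)).
  by rewrite /= in_itv/= le_max lexx/= ge_max ab ge_min lexx.
move=> /(_ (cl s)); apply: cvg_trans.
have : Num.max a (Num.min b x) @[x --> s] --> Num.max a (Num.min b s).
  apply: continuous_max; first exact: cvg_cst.
  apply: continuous_min; [exact: cvg_cst|exact: cvg_id].
move=> cc.
rewrite -[X in X --> _]/(k @ ((fun x => Num.max a (Num.min b x)) @ s)).
apply: cvg_app => P; rewrite /within/= => /cc; rewrite !near_simpl/=.
by apply: filterS => x /(_ (cl x)).
Qed.

(** * The inverse of a primitive *)

Lemma gt0_derive_increasing (R : realType) (f df : R -> R) (i : interval R) :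
  (forall x, x \in i -> is_derive x 1 f (df x)) ->
  (forall x, x \in i -> 0 < df x) ->
  {in i &, {homo f : x y / x < y}}.
Proof.
move=> fdf df0 x y xi yi xy.
have sub : {subset `[x, y] <= i}.
  by move=> z; rewrite in_itv/= => zxy; exact: (interval_is_interval xi yi).
have [z zxy] : exists2 z, z \in `]x, y[ & f y - f x = df z * (y - x).
  apply: (@MVT _ f df x y xy) => [z /subset_itv_oo_cc /sub /fdf//|].
  by apply: derivable_within_continuous => z /sub /fdf [].
rewrite -subr_gt0 => ->.
by rewrite mulr_gt0 ?subr_gt0// df0 ?sub ?subset_itv_oo_cc.
Qed.

(** Separation of variables for [F' = 1 / k(F)]: a solution is the inverse of a
    primitive of [k]. The derivatives at the endpoints are two-sided because the
    primitive is inverted on an interval slightly larger than [[c, d]]. *)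
Lemma inverse_primitive (R : realType) (k : R -> R) (c d : R) :
  c < d -> continuous k -> (forall s, 0 < k s) ->
  exists a b (F : R -> R), [/\ a < b, F a = c, F b = d &
    forall x, x \in `[a, b] -> is_derive x 1 F (k (F x))^-1].
Proof.
move=> cd ck k0.
pose H y := \int[lebesgue_measure]_(t in `[c - 1, y]) k t.
have dH y : y \in `]c - 1, d + 1[ -> is_derive y 1 H (k y).
  rewrite in_itv/= => /andP[cy yd].
  have [] := @continuous_FTC1_closed R k (c - 1) y (d + 1) yd _ cy (ck y).
    apply: continuous_compact_integrable; first exact: segment_compact.
    exact: continuous_subspaceT.
  by rewrite derive1E => dHy Hy; exact: DeriveDef.
have H_incr := gt0_derive_increasing _ _ _ _ dH (fun y _ => k0 y).
have ci : c \in `]c - 1, d + 1[ by rewrite in_itv/=; lra.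
have di : d \in `]c - 1, d + 1[ by rewrite in_itv/=; lra.
have sub : {subset `[c, d] <= `]c - 1, d + 1[}.
  by move=> y; rewrite !in_itv/=; lra.
pose F := pinv `]c - 1, d + 1[ H.
have HK : {in `]c - 1, d + 1[, cancel H F}.
  move=> y yi; apply: pinvKV; last by rewrite inE.
  move=> u v; rewrite !inE/= => ui vi.
  exact: inc_inj_in (le_mono_in H_incr) u v ui vi.
exists (H c), (H d), F; split; rewrite ?HK//; first exact: H_incr.
have Hcd : H c <= H d by rewrite ltW// H_incr.
move=> x; rewrite in_itv/= => xab.
have [y ycd <-] : exists2 y, y \in `[c, d] & H y = x.
  apply: IVT; first exact: ltW.
    by apply: derivable_within_continuous => z /sub /dH [].
  by rewrite min_l// max_r.
have yi := sub _ ycd; rewrite HK//; apply: is_derive_inverse; last 2 first.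
- exact: dH.
- by rewrite gt_eqF.
- by apply: filterS (near_in_itvoo yi) => z /HK.
- apply: filterS (near_in_itvoo yi) => z zi.
  by have [/derivable1_diffP/differentiable_continuous] := dH z zi.
Qed.

(** By the intermediate value theorem; the preimage is interior because the
    endpoints of [[a, b]] have other values. *)
Lemma preimage_itvoo (R : realType) (F : R -> R) (a b t : R) :
  a <= b -> {within `[a, b], continuous F} -> t \in `]F a, F b[ ->
  exists2 c, c \in `]a, b[ & F c = t.
Proof.
move=> ab Fcont; rewrite in_itv/= => /andP[at_ tb].
have [c c_ab Fc] : exists2 c, c \in `[a, b] & F c = t.
  by apply: IVT => //; rewrite ge_min le_max (ltW at_) (ltW tb) orbT.
have ca : c != a by apply: contraTneq at_ => ca; rewrite -Fc ca ltxx.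
have cb : c != b by apply: contraTneq tb => cb; rewrite -Fc cb ltxx.
exists c => //; move: c_ab; rewrite !in_itv/= => /andP[a_c c_b].
by rewrite !lt_neqAle eq_sym ca a_c cb c_b.
Qed.

(** * The density *)

Lemma integral_derive_itvoo (R : realType) (F g : R -> R) (a b : R) :
  a < b -> (forall x, x \in `[a, b] -> is_derive x 1 F (g x)) ->
  {within `[a, b], continuous g} ->
  (\int[lebesgue_measure]_(x in `]a, b[) (g x)%:E = (F b - F a)%:E)%E.
Proof.
move=> ab dF cg.
have Fc x : x \in `[a, b] -> {for x, continuous F}.
  by move=> /dF [/derivable1_diffP/differentiable_continuous].
have mg : measurable_fun `]a, b[ (EFin \o g).
  apply/measurable_EFinP; apply: (@measurable_funS _ _ _ _ `[a, b]) => //.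
    exact: subset_itv_oo_cc.
  exact: subspace_continuous_measurable_fun.
rewrite -(integral_itv_bndoo true false mg) (@continuous_FTC2 _ _ F) ?EFinB//.
  split => [x /subset_itv_oo_cc /dF []//| |].
    by apply: cvg_at_right_filter; apply: Fc; rewrite in_itv/= lexx ltW.
  by apply: cvg_at_left_filter; apply: Fc; rewrite in_itv/= lexx ltW.
by move=> x /subset_itv_oo_cc /dF [dFx Fx]; rewrite derive1E.
Qed.

Lemma has_density_exists (R : realType) (f : R -> R) :
  measurable_fun [set: measurableTypeR R] f -> (forall x, 0 <= f x) ->
  (\int[lebesgue_measure]_x (f x)%:E = 1)%E ->
  exists mu : probability (measurableTypeR R) R, has_density mu f.
Proof.
move=> mf f0 f1.
pose nu (A : set (measurableTypeR R)) :=
  (\int[lebesgue_measure]_(x in A) (f x)%:E)%E.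
have nu0 : nu set0 = 0%E by exact: integral_set0.
have nu_ge0 A : (0 <= nu A)%E by apply: integral_ge0 => x _; rewrite lee_fin.
have nu_sigma : semi_sigma_additive nu.
  move=> A mA tA mUA; rewrite /nu ge0_integral_bigcup//.
  - by apply: is_cvg_ereal_nneg_natsum_cond => n _ _; exact: nu_ge0.
  - by apply/measurable_EFinP; exact: measurable_funTS.
  - by move=> x _; rewrite lee_fin.
pose nuM := HB.pack_for {measure set (measurableTypeR R) -> \bar R} nu
  (isMeasure.Build _ _ _ nu nu0 nu_ge0 nu_sigma).
pose nuP := HB.pack_for (probability (measurableTypeR R) R) nu
  (Measure.class nuM) (@Measure_isProbability.Build _ _ R nuM f1).
by exists nuP; split.
Qed.

(** * The distribution function and its four properties *)

Theorem lemma8 (R : realType) (d : nat)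
    (gamma gamma' gamma'' : R -> 'rV[R]_d) (nacc' : R -> R)
    (C2 : is_C2_on `[0, 1] gamma gamma' gamma'')
    (unit_speed : forall s : R, s \in `[0, 1] -> enorm (gamma' s) = 1)
    (nonvanishing : forall s : R, s \in `[0, 1] -> enorm (gamma'' s) != 0)
    (norm_diff : is_derivative_on `[0, 1]
       (fun s => enorm (gamma'' s)) nacc')
    (norm_diff_bounded : exists M : R,
       forall s : R, s \in `[0, 1] -> `|nacc' s| <= M) :
  exists (a b : R) (F : R -> R)
         (mu : probability (measurableTypeR R) R) (f : R -> R),
    a < b /\
    (* F maps (a, b) to [0, 1] and is twice differentiable *)
    (forall x : R, x \in `]a, b[ ->
       [/\ F x \in `[0, 1], derivable F x 1 & derivable (derive1 F) x 1]) /\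
    (forall t : R, t \in `]a, b[ ->
       (F t)%:E = \int[lebesgue_measure]_(s in `]a, t[)
                    ((enorm (gamma'' (F s)))^-1)%R%:E)%E /\
    F x @[x --> a^'+] --> (0 : R) /\
    F x @[x --> b^'-] --> (1 : R) /\
    (* mu is supported on (a, b), with distribution function F and density f *)
    mu `]a, b[%classic = 1%E /\
    (forall x : R, x \in `]a, b[ -> mu `]-oo, x]%classic = (F x)%:E) /\
    has_density mu f /\
    (* A *)
    (forall x : R, x \in `]a, b[ -> 0 < f x /\ derivable f x 1) /\
    (* B *)
    {ae lebesgue_measure, forall t : R, t \in `]0, 1[ ->
       I_function a b F f t = (enorm (gamma'' t))^-1} /\
    (* C *)
    (ereal_sup [set (F x * (1 - F x) / f x ^+ 2 * `|derive1 f x|)%R%:E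
               | x in `]a, b[] < +oo)%E /\
    (* D *)
    (J2 a b F f < +oo)%E.
Proof.
have [M M_ub] := norm_diff_bounded.
pose k s := enorm (gamma'' s).
have k_gt0 (s : R) : s \in `[0, 1] -> 0 < k s.
  by move=> s01; rewrite lt_neqAle eq_sym nonvanishing//= sqrtr_ge0.
pose kc s := k (Num.max 0 (Num.min 1 s)).
have clamp01 s : Num.max 0 (Num.min 1 s) \in `[0 : R, 1].
  by rewrite in_itv/= le_max lexx/= ge_max ler01 ge_min lexx.
have kcE (s : R) : s \in `[0, 1] -> kc s = k s.
  by rewrite in_itv/= => /andP[s0 s1]; rewrite /kc min_r// max_r.
have kc_gt0 s : 0 < kc s by exact: k_gt0.
have kc_cont : continuous kc.
  apply: clamp_extension; first exact: ler01.
  apply/subspace_continuousP => s s01.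
  exact: is_derivative_on_continuous norm_diff s01.
have [m m_gt0 kc_ge] : exists2 m : R, 0 < m & forall s, m <= kc s.
  have [c _ c_min] := EVT_min ler01 (continuous_subspaceT kc_cont).
  exists (kc c) => // s; apply: le_trans (c_min _ (clamp01 s)) _.
  by rewrite kcE.
have [K kc_le] : exists K, forall s, kc s <= K.
  have [c _ c_max] := EVT_max ler01 (continuous_subspaceT kc_cont).
  exists (kc c) => s; apply: le_trans _ (c_max _ (clamp01 s)).
  by rewrite [in leRHS]kcE.
have [a [b [F [ab Fa Fb dF]]]] :=
  inverse_primitive R kc 0 1 ltr01 kc_cont kc_gt0.
have sub_ab : {subset `]a, b[ <= `[a, b]} by exact: subset_itv_oo_cc.
have F_incr : {in `[a, b] &, {homo F : x y / x < y}}.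
  by apply: gt0_derive_increasing dF _ => x _; rewrite invr_gt0.
have a_ab : a \in `[a, b] by rewrite in_itv/= lexx ltW.
have b_ab : b \in `[a, b] by rewrite in_itv/= lexx ltW.
have F01 x : x \in `]a, b[ -> F x \in `]0, 1[.
  move=> xab; have := xab; rewrite !in_itv/= => /andP[ax xb].
  by rewrite -Fa -Fb !F_incr// sub_ab.
have F01c x : x \in `]a, b[ -> F x \in `[0, 1].
  by move=> /F01; exact: subset_itv_oo_cc.
have F_cont x : x \in `[a, b] -> {for x, continuous F}.
  by move=> /dF [/derivable1_diffP/differentiable_continuous].
pose g x := (kc (F x))^-1.
have g_gt0 x : 0 < g x by rewrite invr_gt0.
have gE x : x \in `]a, b[ -> g x = (enorm (gamma'' (F x)))^-1.
  by move=> xab; rewrite /g kcE// F01c.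
have g_cont : {within `[a, b], continuous g}.
  apply: continuous_in_subspaceT => x; rewrite inE => xab.
  apply: cvgV; first by rewrite gt_eqF.
  by apply: continuous_comp; [exact: F_cont|exact: kc_cont].
have int_g t : t \in `]a, b] ->
    (\int[lebesgue_measure]_(x in `]a, t[) (g x)%:E = (F t)%:E)%E.
  rewrite in_itv/= => /andP[a_t tb].
  have sub : {subset `[a, t] <= `[a, b]}.
    by move=> x; rewrite !in_itv/= => /andP[-> /le_trans ->].
  have -> : F t = F t - F a by rewrite Fa subr0.
  apply: integral_derive_itvoo a_t (fun x xat => dF x (sub x xat)) _.
  exact: continuous_subspaceW g_cont.
pose f := g \_ `]a, b[.
have fE x : x \in `]a, b[ -> f x = g x.
  by move=> xab; rewrite /f patchE mem_set.
have f_near x : x \in `]a, b[ -> \near x, g x = f x.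
  by move=> /near_in_itvoo; apply: filterS => y /fE.
have int_f A : (\int[lebesgue_measure]_(x in A) (f x)%:E =
    \int[lebesgue_measure]_(x in A `&` `]a, b[) (g x)%:E)%E.
  rewrite integral_mkcondr; apply: eq_integral => x _.
  by rewrite /f !patchE; case: ifPn.
have mg : measurable_fun `]a, b[ g.
  apply: (@measurable_funS _ _ _ _ `[a, b]) => //.
  exact: subspace_continuous_measurable_fun.
have mf : measurable_fun [set: measurableTypeR R] f.
  exact: (measurable_restrictT g (measurable_itv _)).1 mg.
have f_ge0 x : 0 <= f x by rewrite /f patchE; case: ifP => // _; exact: ltW.
have int_f1 : (\int[lebesgue_measure]_x (f x)%:E = 1)%E.
  by rewrite int_f setTI int_g ?Fb// in_itv/= ab lexx.
have [mu mu_f] := has_density_exists _ _ mf f_ge0 int_f1.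
have [_ _ mu_int] := mu_f.
(* the chain rule for [1 / k(F)], with [F' = g]; the value [F x] is interior to
   [[0, 1]], so the derivative of [k] there is two-sided *)
pose g' x := - (kc (F x)) ^- 2 *: (nacc' (F x) * g x).
have dg x : x \in `]a, b[ -> is_derive x 1 g (g' x).
  move=> xab; have dFx := dF x (sub_ab x xab).
  have F01x := F01 x xab.
  apply: is_deriveV; first by rewrite gt_eqF.
  have dk : is_derive (F x) 1 kc (nacc' (F x)).
    have dkx : is_derive (F x) 1 k (nacc' (F x)).
      apply: is_derivative_on_is_derive norm_diff _.
      by apply: filterS (near_in_itvoo F01x) => s; exact: subset_itv_oo_cc.
    apply: near_eq_is_derive dkx.
    apply: filterS (near_in_itvoo F01x) => s s01.
    by rewrite kcE// subset_itv_oo_cc.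
  exact: is_derive1_comp.
exists a, b, F, mu, f; split; [|split; [|split; [|split; [|split; [|split; [|
  split; [|split; [|split; [|split; [|split]]]]]]]]]] => //.
- move=> x xab; split; first exact: F01c.
    by have [] := dF x (sub_ab x xab).
  have [dgx _] := dg x xab; apply: near_eq_derivable dgx.
  apply: filterS (near_in_itvoo xab) => y /sub_ab /dF [dFy Fy].
  by rewrite derive1E Fy.
- move=> t tab; rewrite -int_g; last exact: subset_itv_oo_oc tab.
  apply: eq_integral => x; rewrite inE/= => xat; rewrite gE//.
  move: tab xat; rewrite !in_itv/= => /andP[_ tb] /andP[-> xt].
  exact: lt_trans tb.
- by rewrite -[X in _ --> X]Fa; apply: cvg_at_right_filter; exact: F_cont.
- by rewrite -[X in _ --> X]Fb; apply: cvg_at_left_filter; exact: F_cont.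
- by rewrite mu_int// int_f setIid int_g ?Fb// in_itv/= ab lexx.
- move=> x xab; have := xab; rewrite in_itv/= => /andP[ax xb].
  have x_oc : x \in `]a, b] by exact: subset_itv_oo_oc.
  rewrite mu_int// int_f -(int_g x)//.
  have -> : `]-oo, x] `&` `]a, b[ = `]a, x]%classic.
    apply/seteqP; split => y /=; rewrite !in_itv/=; lra.
  rewrite integral_itv_bndoo//; apply/measurable_EFinP.
  apply: measurable_funS mg => // y; rewrite /= !in_itv/=; lra.
- move=> x xab; rewrite fE//; split=> //.
  by have [dgx _] := dg x xab; exact: near_eq_derivable (f_near x xab) dgx.
- apply: aeW => t t01; rewrite /I_function.
  have [c c_ab Fc] : exists2 c, c \in `]a, b[ & F c = t.
    apply: preimage_itvoo; rewrite ?Fa ?Fb ?ltW//.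
    by apply: derivable_within_continuous => x /dF [].
  have F_inj : {in `]a, b[%classic &, injective F}.
    move=> u v; rewrite !inE/= => /sub_ab u_ab /sub_ab v_ab.
    exact: inc_inj_in (le_mono_in F_incr) u v u_ab v_ab.
  by rewrite -Fc pinvKV ?inE// fE// gE.
- apply: (@le_lt_trans _ _ (M / m)%:E); last exact: ltry.
  apply: ge_ereal_sup => _ [x xab <-]; rewrite lee_fin.
  have -> : derive1 f x = g' x.
    rewrite derive1E.
    by have [_ <-] := near_eq_is_derive (f_near x xab) (dg x xab).
  rewrite fE//.
  have /andP[F0 F1] : 0 < F x < 1 by have := F01 x xab; rewrite in_itv.
  have kF0 := kc_gt0 (F x).
  have -> : F x * (1 - F x) / g x ^+ 2 * `|g' x| =
      F x * (1 - F x) * (`|nacc' (F x)| / kc (F x)).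
    rewrite /g' /g -[_ *: _]/(_ * _) !normrM normrN !normfV.
    rewrite normrX !(gtr0_norm kF0); field; exact: lt0r_neq0.
  rewrite -[leRHS]mul1r; apply: ler_pM.
  - by rewrite mulr_ge0// ?subr_ge0 ltW.
  - by rewrite divr_ge0// ltW.
  - nra.
  - apply: ler_pM => //; first by rewrite invr_ge0 ltW.
      by apply: M_ub; exact: F01c.
    by rewrite lef_pV2.
- apply: (@le_lt_trans _ _ (\int[lebesgue_measure]_(x in `]a, b[) K%:E)%E).
    apply: ge0_le_integral => //.
    - move=> x xab; rewrite lee_fin fE//.
      have := F01 x xab; rewrite in_itv/= => /andP[F0 F1].
      apply: divr_ge0; last exact: ltW.
      by apply: mulr_ge0; rewrite ?subr_ge0 ltW.
    - apply/measurable_EFinP.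
      pose phi (u : R) := u * (1 - u) * kc u.
      apply: (@eq_measurable_fun _ _ _ _ _ (phi \o F)).
        by move=> x; rewrite inE/= => xab; rewrite /phi fE// /g invrK.
      apply: subspace_continuous_measurable_fun => //.
      apply: continuous_in_subspaceT => x; rewrite inE => /sub_ab xab.
      apply: continuous_comp; first exact: F_cont.
      apply: cvgM; last exact: kc_cont.
      apply: cvgM; first exact: cvg_id.
      by apply: cvgB; [exact: cvg_cst|exact: cvg_id].
    - move=> x xab; rewrite lee_fin fE// /g invrK.
      have := F01 x xab; rewrite in_itv/= => /andP[F0 F1].
      have := kc_gt0 (F x); have := kc_le (F x); nra.
  rewrite integral_cst//= lebesgue_measure_itv/= lte_fin ab.
  by rewrite -EFinB -EFinM ltry.
Qed.
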